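(* Let $p>1$, let $Q\subseteq\mathbb{R}^n$ be a fixed dyadic cube, and let $f,F$ be real numbers with $0<f^p<F$ (and $f>0$). Then there do not exist extremal functions for the Bellman function $T_p(f,F)$; that is, there is no non-negative measurable function $\phi$ with $\frac{1}{|Q|}\int_Q\phi(u)\,du=f$, $\frac{1}{|Q|}\int_Q\phi^p(u)\,du=F$ and $$\frac{1}{|Q|}\int_Q(\mathcal{M}_d\phi)^p(u)\,du=T_p(f,F).$$
   Context: $|\cdot|$ is Lebesgue measure on $\mathbb{R}^n$, and the dyadic cubes are those formed by the grids $2^{-N}\mathbb{Z}^n$, $N=0,1,2,\ldots$. The dyadic maximal operator is $$\mathcal{M}_d\phi(x)=\sup\Big\{\frac{1}{|R|}\int_R|\phi(u)|\,du : x\in R,\ R\subseteq\mathbb{R}^n\text{ is a dyadic cube}\Big\}.$$ For $p>1$, a fixed dyadic cube $Q$ and $0<f^p\le F$, the Bellman function is $$T_p(f,F)=\sup\Big\{\frac{1}{|Q|}\int_Q(\mathcal{M}_d\phi)^p : \phi\ge 0,\ \frac{1}{|Q|}\int_Q\phi(u)\,du=f,\ \frac{1}{|Q|}\int_Q\phi^p(u)\,du=F\Big\}.$$ Convention: the functions $\phi$ considered are functions on $Q$, regarded as functions on $\mathbb{R}^n$ vanishing outside $Q$. *)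

(* Defs.v *)
From HB Require Import structures.
From mathcomp Require Import all_boot all_order all_algebra.
From mathcomp Require Import all_classical all_reals all_analysis.

Set Implicit Arguments.
Unset Strict Implicit.
Unset Printing Implicit Defensive.
Import Order.TTheory GRing.Theory Num.Theory.
Import numFieldNormedType.Exports.

Local Open Scope classical_set_scope.
Local Open Scope ring_scope.

(* Points of R^n are n-tuples.  Lebesgue measure is built in two steps: the
   n-fold product of the one-dimensional Lebesgue measure on the Borel sets of
   R^n, and then its completion (the Caratheodory extension), so that
   "measurable" below means Lebesgue measurable. *)

Definition tcons (T : Type) (n : nat) (x : T * n.-tuple T) : n.+1.-tuple T :=
  [tuple of x.1 :: x.2].

Definition tuncons (T : Type) (n : nat) (x : n.+1.-tuple T) : T * n.-tuple T :=
  (thead x, [tuple of behead x]).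

Lemma tconsK (T : Type) (n : nat) : cancel (@tcons T n) (@tuncons T n).
Proof.
by move=> [a t]; rewrite /tuncons /tcons theadE/=; congr pair; exact: val_inj.
Qed.

Lemma tunconsK (T : Type) (n : nat) : cancel (@tuncons T n) (@tcons T n).
Proof. by move=> t; rewrite [t in RHS]tuple_eta. Qed.

Section tcons_measurable.
Context d (T : measurableType d) (n : nat).

Lemma measurable_tcons : measurable_fun [set: T * n.-tuple T] (@tcons T n).
Proof. exact: measurable_cons. Qed.

Lemma measurable_tuncons : measurable_fun [set: n.+1.-tuple T] (@tuncons T n).
Proof.
apply/measurable_fun_pairP; split => /=.
  exact: (measurable_tnth (ord0 : 'I_n.+1)).
exact: measurable_behead.
Qed.

End tcons_measurable.

(* Reproved here: inference of the library's sigma-finiteness instance on a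
   product of measures is shadowed by a later instance. *)
Lemma sigma_finite_prod d1 d2 (T1 : measurableType d1) (T2 : measurableType d2)
    (R : realType) (m1 : {sigma_finite_measure set T1 -> \bar R})
    (m2 : {sigma_finite_measure set T2 -> \bar R}) :
  sigma_finite setT (m1 \x m2)%E.
Proof.
have /sigma_finiteP[F [TF ndF Foo]] := sigma_finiteT m1.
have /sigma_finiteP[G [TG ndG Goo]] := sigma_finiteT m2.
exists (fun k => F k `*` G k).
  rewrite -setXTT TF TG predeqE => -[x y]; split.
    move=> [/= [k _ Fkx] [l _ Gly]]; exists (maxn k l) => //; split.
    - by move: x Fkx; exact/subsetPset/ndF/leq_maxl.
    - by move: y Gly; exact/subsetPset/ndG/leq_maxr.
  by move=> [k _ []/= ? ?]; split; exists k.
move=> k; have [? ?] := Foo k; have [? ?] := Goo k.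
split; first exact: measurableX.
by rewrite product_measure1E// lte_mul_pinfty// ge0_fin_numE.
Qed.

Section borel_lebesgue_measure.
Context (R : realType).
Local Open Scope ereal_scope.

Section prod_lebesgue.
Context (n : nat) (mu : {sigma_finite_measure set (n.-tuple R) -> \bar R}).

Definition prod_lebesgue : set (n.+1.-tuple R) -> \bar R :=
  pushforward (@lebesgue_measure R \x mu) (@tcons R n).

Let prod_lebesgue0 : prod_lebesgue set0 = 0.
Proof. by rewrite /prod_lebesgue /pushforward preimage_set0 measure0. Qed.

Let prod_lebesgue_ge0 A : 0 <= prod_lebesgue A.
Proof. exact: (measure_ge0 (@lebesgue_measure R \x mu)). Qed.

Let prod_lebesgue_sigma_additive : semi_sigma_additive prod_lebesgue.
Proof.
have mc A : measurable A -> measurable (@tcons R n @^-1` A).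
  by move=> mA; rewrite -[X in measurable X]setTI; exact: measurable_tcons.
move=> F mF tF mUF; rewrite /prod_lebesgue /pushforward preimage_bigcup.
apply: (@measure_semi_sigma_additive _ _ _ (@lebesgue_measure R \x mu)).
- by move=> k; exact: mc.
- apply/trivIsetP => i j _ _ ij; rewrite -preimage_setI.
  by move/trivIsetP : tF => /(_ _ _ _ _ ij) ->//; rewrite preimage_set0.
- by rewrite -preimage_bigcup; exact: mc.
Qed.

HB.instance Definition _ := isMeasure.Build _ _ _ prod_lebesgue
  prod_lebesgue0 prod_lebesgue_ge0 prod_lebesgue_sigma_additive.

Let prod_lebesgue_sigma_finite : sigma_finite setT prod_lebesgue.
Proof.
have [F TF mF] := sigma_finite_prod (@lebesgue_measure R) mu.
exists (fun k => @tuncons R n @^-1` F k).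
  by rewrite -preimage_bigcup -TF preimage_setT.
move=> k; have [mFk Fk] := mF k; split.
  by rewrite -[X in measurable X]setTI; exact: measurable_tuncons.
rewrite /prod_lebesgue /pushforward -comp_preimage.
rewrite (_ : @tuncons R n \o @tcons R n = id)//.
by apply/funext => x /=; rewrite tconsK.
Qed.

HB.instance Definition _ := Measure_isSigmaFinite.Build _ _ _ prod_lebesgue
  prod_lebesgue_sigma_finite.

End prod_lebesgue.

Fixpoint borel_lebesgue (n : nat) :
    {sigma_finite_measure set (n.-tuple R) -> \bar R} :=
  match n with
  | 0 => \d_([tuple] : 0.-tuple R)
  | m.+1 => prod_lebesgue (borel_lebesgue m)
  end.

End borel_lebesgue_measure.

Definition leb_space (R : realType) (n : nat) : Type :=
  caratheodory_type (borel_lebesgue R n)^*%mu.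

HB.instance Definition _ (R : realType) (n : nat) :=
  Measurable.on (leb_space R n).

Definition lebesgue (R : realType) (n : nat) : set (leb_space R n) -> \bar R :=
  @completed_measure_extension _ _ _ (borel_lebesgue R n).
Arguments lebesgue {R n}.

HB.instance Definition _ (R : realType) (n : nat) :=
  Measure.on (@lebesgue R n).

Lemma lebesgue_sigma_finite (R : realType) (n : nat) :
  sigma_finite setT (@lebesgue R n).
Proof. exact/completed_measure_extension_sigma_finite/sigma_finiteT. Qed.

HB.instance Definition _ (R : realType) (n : nat) :=
  Measure_isSigmaFinite.Build _ _ _ (@lebesgue R n)
    (@lebesgue_sigma_finite R n).

(* Half-open, so that the cubes of a given generation N partition R^n. *)
Definition dyadic_box (R : realType) (n N : nat) (k : 'I_n -> int) :
    set (leb_space R n) :=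
  [set x : n.-tuple R | forall i : 'I_n,
     (k i)%:~R / 2 ^+ N <= tnth x i < (k i + 1)%:~R / 2 ^+ N].

Definition dyadic_cube (R : realType) (n : nat) : set (set (leb_space R n)) :=
  [set Q | exists (N : nat) (k : 'I_n -> int), Q = dyadic_box N k].

Section bellman.
Context (R : realType) (n : nat).
Local Notation Rn := (leb_space R n).
Local Open Scope ereal_scope.

Definition average (A : set Rn) (g : Rn -> \bar R) : \bar R :=
  ((fine (lebesgue A))^-1)%:E * \int[lebesgue]_(u in A) g u.

Definition dyadic_maximal (phi : Rn -> R) (x : Rn) : \bar R :=
  ereal_sup [set average A (fun u => `|phi u|%:E) |
    A in [set A | dyadic_cube A /\ A x]].

(* The competitors live on Q; they are extended by 0 to the whole of R^n. *)
Definition admissible (p : R) (Q : set Rn) (f F : R) : set (Rn -> R) :=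
  [set phi : Rn -> R |
    [/\ measurable_fun [set: Rn] phi,
        forall u, (0 <= phi u)%R,
        forall u, ~ Q u -> phi u = 0%R,
        average Q (fun u => (phi u)%:E) = f%:E &
        average Q (fun u => (phi u `^ p)%:E) = F%:E]].

Definition bellman (p : R) (Q : set Rn) (f F : R) : \bar R :=
  ereal_sup [set average Q (fun u => dyadic_maximal phi u `^ p) |
    phi in admissible p Q f F].

End bellman.

(* Main.v *)
(* The value of the Bellman function is F w^p, where w in (1, p/(p-1)) solves
   p w^(p-1) - (p-1) w^p = f^p/F; it is a strict upper bound for every
   competitor, yet competitors come arbitrarily close to it.

   Upper bound.  Let s_n be the average of phi over the generation-n cube and
   m_n the running maximum of the s_n, so that m_n increases to the maximal
   function on Q.  At a time where m jumps from a to s_{n+1} = b > a, Young's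
   inequality p b a^(p-1) < b^p + (p-1) a^p shows that
   p int phi m_n^(p-1) - (p-1) int m_n^p strictly increases; it never
   decreases, and it starts from f^p |Q|.  Young's inequality
   p phi m^(p-1) <= w^(p-1) phi^p + (p-1) m^p / w then gives
   int m_n^p <= F w^p |Q| - c with c > 0 independent of n.  If m never jumps,
   the maximal function is f on Q, and f^p < F.

   Near-extremal competitors.  Remove from Q one small subcube of relative
   measure alpha, from each remaining cube of the same size again one subcube of
   relative measure alpha, and so on.  A function equal to c rho^k on the cubes
   removed at step k has the average c' rho^k over each cube surviving k steps;
   its L^p norm can be tuned by the choice of rho, and int (M phi)^p / int phi^p
   tends to w^p as alpha tends to 0. *)
Require Import Defs.
From mathcomp Require Import all_boot all_order all_algebra.
From mathcomp Require Import all_classical all_reals all_analysis.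
From mathcomp Require Import measurable_realfun zify ring lra.

Set Implicit Arguments.
Unset Strict Implicit.
Unset Printing Implicit Defensive.
Import Order.TTheory GRing.Theory Num.Theory.
Import numFieldNormedType.Exports.
Local Open Scope classical_set_scope.
Local Open Scope ring_scope.

(** * Real inequalities *)

Section real_inequalities.
Context (R : realType) (p : R).

Lemma powR_split (x : R) : 1 < p -> 0 <= x -> x `^ p = x * x `^ (p - 1).
Proof.
move=> p1 x0; rewrite -{2}(powRr1 x0) -powRD; first by congr (_ `^ _); ring.
by apply/implyP => /eqP ?; exfalso; lra.
Qed.

(** Young's inequality for [x] and y^(p-1) with the conjugate exponents [p] and [p / (p - 1)],
    multiplied by [p]. *)
Lemma young_powR (x y : R) : 1 < p -> 0 <= x -> 0 <= y ->
  p * (x * y `^ (p - 1)) <= x `^ p + (p - 1) * y `^ p.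
Proof.
move=> p1 x0 y0.
have p0 : 0 < p by lra.
have p10 : 0 < p - 1 by lra.
have q0 : 0 < p / (p - 1) by rewrite divr_gt0.
have := @conjugate_powR _ x (y `^ (p - 1)) p (p / (p - 1)) x0 (powR_ge0 _ _) p0 q0.
rewrite -powRrM mulrCA divff ?gt_eqF// mulr1 invf_div => /(_ _) H.
have {}H := H ltac:(field; lra).
rewrite -(ler_pM2l p0) in H; apply: (le_trans H).
rewrite le_eqVlt; apply/orP; left; apply/eqP; field; lra.
Qed.

(** Strictness comes from the midpoint [c]: the weak inequalities for the pairs (b, c) and (c, a)
    add up to the claim with the surplus p (b - c) (c^(p-1) - a^(p-1)) > 0. *)
Lemma young_powR_lt (a b : R) : 1 < p -> 0 < a -> a < b ->
  p * (b * a `^ (p - 1)) < b `^ p + (p - 1) * a `^ p.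
Proof.
move=> p1 a0 ab.
pose c := (a + b) / 2.
have ac : a < c by rewrite /c; lra.
have cb : c < b by rewrite /c; lra.
have H1 := @young_powR b c p1 ltac:(lra) ltac:(lra).
have H2 := @young_powR c a p1 ltac:(lra) ltac:(lra).
rewrite (@powR_split c) in H1 H2; [|lra..].
rewrite (@powR_split a) in H2 *; [|lra..].
have H3 : a `^ (p - 1) < c `^ (p - 1).
  by apply: gt0_ltr_powR => //; rewrite ?nnegrE; lra.
move: H1 H2 H3; set A := a `^ _; set C := c `^ _; set B := b `^ _.
move=> H1 H2 H3.
have H4 : 0 < p * ((b - c) * (C - A)) by rewrite mulr_gt0 ?mulr_gt0//; lra.
nra.
Qed.

(* The function written H_p in the literature; T_p(f, F) = F w^p where
   H_p(w) = f^p / F. *)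
Definition Hfun (w : R) := w `^ (p - 1) * (p - (p - 1) * w).

(** Young's inequality for the pair (a, b) bounds [Hfun a - Hfun b] below by p (a - 1) (b^(p-1) -
    a^(p-1)). *)
Lemma Hfun_decr (a b : R) : 1 < p -> 1 < a -> a < b -> Hfun b < Hfun a.
Proof.
move=> p1 a1 ab; rewrite /Hfun.
have H1 := @young_powR a b p1 ltac:(lra) ltac:(lra).
rewrite !powR_split in H1; [|lra..].
have H3 : a `^ (p - 1) < b `^ (p - 1).
  by apply: gt0_ltr_powR => //; rewrite ?nnegrE; lra.
move: H1 H3; set A := a `^ _; set B := b `^ _ => H1 H3.
have H4 : 0 < p * ((a - 1) * (B - A)) by rewrite mulr_gt0 ?mulr_gt0//; lra.
nra.
Qed.

Lemma powR_continuous_at (q x : R) : 0 < x -> {for x, continuous (fun z : R => z `^ q)}.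
Proof.
move=> x0; apply: differentiable_continuous; apply/derivable1_diffP.
by apply: derivable_powR; rewrite in_itv/= x0.
Qed.

(** Intermediate value theorem: [Hfun] is 1 at 1 and 0 at [p / (p - 1)]. *)
Lemma Hfun_surj (h : R) : 1 < p -> 0 < h -> h < 1 ->
  exists2 w, 1 < w & w < p / (p - 1) /\ Hfun w = h.
Proof.
move=> p1 h0 h1.
have p10 : p - 1 != 0 by lra.
have q1 : 1 < p / (p - 1) by rewrite ltr_pdivlMr; lra.
have H1 : Hfun 1 = 1 by rewrite /Hfun powR1; ring.
have Hq : Hfun (p / (p - 1)) = 0.
  by rewrite /Hfun (_ : p - _ = 0) ?mulr0//; field.
have [] := @IVT R Hfun 1 (p / (p - 1)) h (ltW q1).
- apply: continuous_in_subspaceT => x /set_mem /=; rewrite in_itv/= => /andP[x1 _].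
  apply: cvgM; first by apply: powR_continuous_at; lra.
  by apply: cvgB; [exact: cvg_cst|apply: cvgM; [exact: cvg_cst|exact: cvg_id]].
- by rewrite H1 Hq ge_min le_max !(ltW h0) !(ltW h1) orbT.
move=> w; rewrite in_itv/= => /andP[w1 wq] Hw; exists w.
  rewrite lt_neqAle w1 andbT; apply/eqP => ew; rewrite -ew in Hw; lra.
split=> //; rewrite lt_neqAle wq andbT; apply/eqP => ew; rewrite ew in Hw; lra.
Qed.

Lemma exprn_small (r e : R) : 0 < r -> r < 1 -> 0 < e ->
  exists2 m, (0 < m)%N & r ^+ m < e.
Proof.
move=> r0 r1 e0.
have : (fun m => r ^+ m) @ \oo --> (0 : R) by apply: cvg_expr; rewrite gtr0_norm.
move/cvgrPdist_lt => /(_ e e0)[m _ Hm]; exists m.+1 => //.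
have := Hm m.+1 (leqnSn m); rewrite /= sub0r normrN gtr0_norm// exprn_gt0//.
Qed.

(* [Hfun] is the limit as [alpha] tends to 0 of
   [w `^ p * (1 - (1 - alpha) * rho `^ p) / alpha]. *)
Lemma discrete_Hfun_surj (r h w1 : R) : 1 < p -> 0 < r -> r < 1 -> 0 < h -> 1 < w1 ->
    w1 < p / (p - 1) -> h < Hfun w1 ->
  exists m w, [/\ (0 < m)%N, w1 <= w &
    w `^ p * (1 - (1 - r ^+ m) * ((1 - r ^+ m / w) / (1 - r ^+ m)) `^ p) = h * r ^+ m].
Proof.
move=> p1 r0 r1 h0 w11 w1q hH.
have p0 : 0 < p by lra.
have p10 : p - 1 != 0 by lra.
(* Chosen so that w1^p t0 = [Hfun w1]. *)
pose t0 := p / w1 - (p - 1).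
have W0 : 0 < w1 `^ p by apply: powR_gt0; lra.
have ht : h < w1 `^ p * t0.
  apply: (lt_le_trans hH); rewrite /Hfun /t0 powR_split; [|lra..].
  by rewrite le_eqVlt; apply/orP; left; apply/eqP; field; lra.
(* The first bound on [a = r ^+ m] makes [D] below positive; the second gives h < w1^p (t0 - a). *)
pose e := Num.min p^-1 (t0 - h / w1 `^ p).
have e0 : 0 < e.
  by rewrite lt_min invr_gt0 p0/= subr_gt0 ltr_pdivrMr// (mulrC t0).
have [m m0 me] := exprn_small r0 r1 e0.
have a0 : 0 < r ^+ m by rewrite exprn_gt0.
move: me; rewrite lt_min; set a := r ^+ m in a0 * => /andP[ap ath].
have a1 : a < 1 by apply: (lt_trans ap); rewrite invf_lt1.
have ap1 : a * p < 1 by rewrite -ltr_pdivlMr// div1r.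
have an1 : 1 - a != 0 by lra.
(* The equation to solve is [G w = h * a]; [G] is at least [h * a] at [w1] and at most 0 at
   [p / (p - 1)]. *)
pose G w := w `^ p * (1 - (1 - a) * ((1 - a / w) / (1 - a)) `^ p).
have G1 : h * a <= G w1.
  rewrite /G.
  set rho := (1 - a / w1) / (1 - a).
  have rho0 : 0 < rho.
    by rewrite divr_gt0 ?subr_gt0// ltr_pdivrMr; lra.
  have := @young_powR 1 rho p1 ler01 (ltW rho0).
  rewrite mul1r powR1 powR_split; [|lra|exact: ltW].
  have : 0 < rho `^ (p - 1) by exact: powR_gt0.
  set V := rho `^ _ => V0 HV.
  have iw : 0 < w1^-1 by rewrite invr_gt0; lra.
  have iw1 : w1^-1 < 1 by rewrite invf_lt1; lra.
  have av1 : a * w1^-1 < 1 by apply: lt_trans a1; rewrite gtr_pMr.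
  have rE : (1 - a) * rho = 1 - a * w1^-1 by rewrite mulrC divfK.
  have D0 : 0 < (1 - a) * p - (p - 1) * (1 - a * w1^-1) by nra.
  (* Young's inequality for (1, rho), collected into an upper bound on [V]; it controls [G w1]
     because (1 - a) rho^p = (1 - a / w1) V. *)
  have HVD : V * ((1 - a) * p - (p - 1) * (1 - a * w1^-1)) <= (1 - a).
    have : (1 - a) * (p * V) <= (1 - a) * (1 + (p - 1) * (rho * V)).
      by rewrite ler_wpM2l//; lra.
    have : (1 - a) * (1 + (p - 1) * (rho * V)) = (1 - a) + (p - 1) * (1 - a * w1^-1) * V
         by rewrite -rE; ring.
    nra.
  rewrite mulrA rE.
  have hta : h / w1 `^ p < t0 - a by lra.
  have ta0 : 0 < t0 - a by apply: lt_trans hta; rewrite divr_gt0.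
  suff K : a * (t0 - a) <= 1 - (1 - a * w1^-1) * V.
    apply: (@le_trans _ _ (w1 `^ p * (a * (t0 - a)))); last by rewrite ler_wpM2l// ltW.
    by move: hta; rewrite ltr_pdivrMr// => K1; nra.
  have t0E : t0 = p * w1^-1 - (p - 1) by [].
  move: D0 HVD; set D := (1 - a) * p - _ => D0 HVD.
  have DE : D = 1 - a * p + (p - 1) * (a * w1^-1) by rewrite /D; ring.
  set X := 1 - _ * V.
  (* [HVD] bounds [D * X] below; as [D <= 1] and [X > 0], the same bound holds for [X]. *)
  have DX : a * (t0 - a) <= D * X.
    have E1 : D * X = D - (1 - a * w1^-1) * (V * D) by rewrite /X; ring.
    have E2 : D - (1 - a * w1^-1) * (1 - a) = a * (t0 - a * w1^-1) by rewrite DE t0E; ring.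
    rewrite E1; apply: (@le_trans _ _ (a * (t0 - a * w1^-1))).
      by rewrite ler_pM2l// lerB// ler_piMr// ltW.
    rewrite -E2 lerB// ler_wpM2l//; lra.
  have X0 : 0 < X.
    by rewrite -(pmulr_rgt0 _ D0); apply: lt_le_trans DX; rewrite mulr_gt0.
  apply: (le_trans DX); rewrite ler_piMl//; first exact: ltW.
  have : (p - 1) * (a * w1^-1) <= (p - 1) * a.
    by rewrite ler_wpM2l//; [lra|rewrite ler_piMr// ltW].
  by rewrite DE; lra.
have G2 : G (p / (p - 1)) <= 0.
  rewrite /G pmulr_rle0 ?powR_gt0 ?divr_gt0//; last lra.
  rewrite subr_le0 -ler_pdivrMl ?subr_gt0// mulr1.
  set rho := (1 - _) / _.
  have rho0 : 0 <= rho.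
    rewrite divr_ge0 ?subr_ge0//; last lra.
    by rewrite invf_div mulrA ler_pdivrMr//; nra.
  have Z0 : 0 < (1 - a)^-1 by rewrite invr_gt0; lra.
  set Z := (1 - a)^-1 in Z0 *.
  have rE : p * rho = p - 1 + Z by rewrite /rho /Z; field; apply/andP; split; lra.
  (* The goal amounts to Z <= rho^p, which follows from p Z^(1/p) <= Z + p - 1 = p rho. *)
  have := @young_powR (Z `^ p^-1) 1 p1 (powR_ge0 _ _) ler01.
  rewrite !powR1 -powRrM mulVf ?gt_eqF// powRr1 ?(ltW Z0)// !mulr1 => HZ.
  have {}HZ : Z `^ p^-1 <= rho by rewrite -(ler_pM2l p0); lra.
  have := @ge0_ler_powR _ p (ltW p0) _ _ _ _ HZ.
  rewrite -powRrM mulVf ?gt_eqF// powRr1 ?(ltW Z0)//; apply => //.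
  by rewrite nnegrE powR_ge0.
have [] := @IVT R G w1 (p / (p - 1)) (h * a) (ltW w1q).
- apply: continuous_in_subspaceT => x /set_mem /=; rewrite in_itv/= => /andP[x1 _].
  have x0 : 0 < x by lra.
  have c1 : {for x, continuous (fun z : R => (1 - a / z) / (1 - a))}.
    apply: cvgM; last exact: cvg_cst.
    apply: cvgB; first exact: cvg_cst.
    apply: cvgM; first exact: cvg_cst.
    by apply: cvgV; [rewrite gt_eqF|exact: cvg_id].
  apply: cvgM; first exact: powR_continuous_at.
  apply: cvgB; first exact: cvg_cst.
  apply: cvgM; first exact: cvg_cst.
  apply: (@continuous_comp _ _ _ _ (fun z : R => z `^ p) _ c1).
  apply: powR_continuous_at; rewrite divr_gt0 ?subr_gt0// ltr_pdivrMr//; lra.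
- have ha0 : 0 < h * a by rewrite mulr_gt0.
  by rewrite ge_min le_max G1 (le_trans G2 (ltW ha0)) !orbT.
move=> w; rewrite in_itv/= => /andP[ww _] Gw; exists m, w.
by split.
Qed.
End real_inequalities.

(** * Trees of sets of geometrically decreasing measure *)

(** An abstraction of the dyadic grids, with r = 2^(-n). Cells are indexed by their points: [C N x]
    is the cell of generation [N] around [x]. *)
Record homogeneous_tree d (T : measurableType d) (R : realType)
    (mu : {measure set T -> \bar R}) (r : R) (C : nat -> T -> set T) : Prop := HomogeneousTree {
  tree_gt0 : 0 < r;
  tree_lt1 : r < 1;
  tree_mem : forall N x, C N x x;
  tree_eq : forall N x y, C N x y -> C N y = C N x;
  treeS : forall N x, C N.+1 x `<=` C N x;
  tree_measurable : forall N x, measurable (C N x);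
  tree_measure : forall N x, mu (C N x) = (r ^+ N)%:E;
  tree_countable : forall N, countable (range (C N)) }.

Section tree.
Context d (T : measurableType d) (R : realType) (mu : {measure set T -> \bar R}).
Context (r : R) (C : nat -> T -> set T).
Context (treeC : homogeneous_tree mu r C).


Lemma tree_sub N N' x : (N <= N')%N -> C N' x `<=` C N x.
Proof.
move=> NN'; rewrite -(subnKC NN'); elim: (N' - N)%N => [|k IH]; first by rewrite addn0.
by rewrite addnS; apply: subset_trans IH; exact: (treeS treeC).
Qed.

(** The unions of cells of generation [N]. *)
Definition saturated N (A : set T) := forall x, A x -> C N x `<=` A.

(** Constancy on the cells of generation [N], that is, measurability for the sigma-algebra that they
    generate. *)
Definition adapted (U : Type) N (g : T -> U) := forall x y, C N x y -> g y = g x.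

Lemma saturated_tree N x : saturated N (C N x).
Proof. by move=> y /(tree_eq treeC) ->. Qed.

Lemma saturatedC N A : saturated N A -> saturated N (~` A).
Proof.
move=> sA x nAx y xy Ay; apply: nAx; apply: (sA y Ay).
by rewrite (tree_eq treeC xy); exact: (tree_mem treeC).
Qed.

Lemma saturatedI N A B : saturated N A -> saturated N B -> saturated N (A `&` B).
Proof. by move=> sA sB x [Ax Bx] y xy; split; [exact: (sA x)|exact: (sB x)]. Qed.

Lemma saturatedS N N' A : (N <= N')%N -> saturated N A -> saturated N' A.
Proof. by move=> NN' sA x Ax; apply: subset_trans (sA x Ax); exact: tree_sub. Qed.

Lemma adaptedS (U : Type) N N' (g : T -> U) : (N <= N')%N -> adapted N g -> adapted N' g.
Proof. by move=> NN' ag x y xy; apply: ag; exact: tree_sub xy. Qed.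

(** An injection of the countably many cells into the integers enumerates them; indices that meet no
    cell of [A] give [set0]. *)
Lemma saturated_partition N A : saturated N A -> exists e : (set T)^nat,
  [/\ trivIset setT e, A = \bigcup_j e j &
      forall j, e j = set0 \/ exists2 x, A x & e j = C N x].
Proof.
move=> sA; have /countable_injP[f f_inj] := tree_countable treeC N.
pose g x := f (C N x).
have gE x y : g x = g y -> C N x = C N y.
  by apply: f_inj; rewrite inE; exact: imageT.
exists (fun j => [set x | A x /\ g x = j]); split.
- apply/trivIsetP => i j _ _ /eqP ij; apply/seteqP; split => // x [[_ gi] [_ gj]].
  by apply: ij; rewrite -gi.
- apply/seteqP; split=> [x Ax|x [j _ []]]//.
  by exists (g x).
- move=> j; have [->|/set0P[x [Ax gx]]] := eqVneq [set x | A x /\ g x = j] set0; first by left.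
  right; exists x => //; apply/seteqP; split => y /=.
    move=> [_ yj]; have -> : C N x = C N y by apply: gE; rewrite gx -yj.
    exact: (tree_mem treeC).
  move=> xy; split; first exact: sA xy.
  by rewrite -gx /g (tree_eq treeC xy).
Qed.

Lemma saturated_measurable N A : saturated N A -> measurable A.
Proof.
move=> /saturated_partition[e [_ -> eP]]; apply: bigcupT_measurable => j.
by have [->|[x _ ->]] := eP j; [exact: measurable0|exact: (tree_measurable treeC)].
Qed.

Lemma adapted_measurable d' (U : measurableType d') N (g : T -> U) D :
  adapted N g -> measurable D -> measurable_fun D g.
Proof.
move=> ag mD _ Y mY; apply: measurableI => //; apply: (@saturated_measurable N).
by move=> x /= Yx y xy /=; rewrite (ag x).
Qed.

Lemma saturated_integral_eq N A (h1 h2 : T -> \bar R) : saturated N A ->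
  measurable_fun A h1 -> measurable_fun A h2 ->
  (forall x, A x -> (0 <= h1 x)%E) -> (forall x, A x -> (0 <= h2 x)%E) ->
  (forall x, A x -> \int[mu]_(y in C N x) h1 y = \int[mu]_(y in C N x) h2 y)%E ->
  (\int[mu]_(y in A) h1 y = \int[mu]_(y in A) h2 y)%E.
Proof.
move=> /saturated_partition[e [te -> eP]] m1 m2 h10 h20 h12.
have me j : measurable (e j).
  by have [->|[x _ ->]] := eP j; [exact: measurable0|exact: (tree_measurable treeC)].
rewrite !ge0_integral_bigcup//; apply: eq_eseriesr => j _.
have [->|[x Ax ->]] := eP j; last exact: h12.
by rewrite !integral_set0.
Qed.

Lemma integral_adapted N x (h : T -> \bar R) : adapted N h ->
  (\int[mu]_(y in C N x) h y = h x * (r ^+ N)%:E)%E.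
Proof.
move=> ah; rewrite -(tree_measure treeC N x) -integral_cst; last exact: (tree_measurable treeC).
by apply: eq_integral => y; rewrite inE => /ah.
Qed.

End tree.

(** * Integrals of non-negative real functions, and powers of suprema *)

Section integral_EFin.
Context d (T : measurableType d) (R : realType) (mu : {measure set T -> \bar R}).
Context (D : set T) (mD : measurable D).
Implicit Types g h : T -> R.

Lemma integral_EFinD g h : measurable_fun D g -> measurable_fun D h ->
  (forall x, D x -> 0 <= g x) -> (forall x, D x -> 0 <= h x) ->
  (\int[mu]_(x in D) (g x + h x)%:E =
   \int[mu]_(x in D) (g x)%:E + \int[mu]_(x in D) (h x)%:E)%E.
Proof.
move=> mg mh g0 h0; under eq_integral do rewrite EFinD.
by rewrite ge0_integralD//; exact/measurable_EFinP.
Qed.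

Lemma integral_EFinZ (k : R) g : measurable_fun D g -> (forall x, D x -> 0 <= g x) -> 0 <= k ->
  (\int[mu]_(x in D) (k * g x)%:E = k%:E * \int[mu]_(x in D) (g x)%:E)%E.
Proof.
move=> mg g0 k0; under eq_integral do rewrite EFinM.
by rewrite ge0_integralZl_EFin//; exact/measurable_EFinP.
Qed.

Lemma le_integral_EFin g h : measurable_fun D g -> measurable_fun D h ->
  (forall x, D x -> 0 <= g x) -> (forall x, D x -> g x <= h x) ->
  (\int[mu]_(x in D) (g x)%:E <= \int[mu]_(x in D) (h x)%:E)%E.
Proof.
move=> mg mh g0 gh; by apply: ge0_le_integral => //; exact/measurable_EFinP.
Qed.

End integral_EFin.

(** Monotonicity of the power gives one inequality and that of the root the other; the supremum may
    be infinite. *)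
Lemma poweR_ereal_sup (R : realType) (p : R) (u : nat -> R) : 0 < p -> (forall n, 0 <= u n) ->
  (ereal_sup (range (EFin \o u)) `^ p = ereal_sup (range (fun n => (u n `^ p)%:E)))%E.
Proof.
move=> p0 u0; apply/eqP; rewrite eq_le; apply/andP; split.
  have : (0 <= ereal_sup (range (fun n => (u n `^ p)%:E)))%E.
    apply: (@le_trans _ _ (u 0%N `^ p)%:E); first by rewrite lee_fin powR_ge0.
    by apply: ereal_sup_ubound; exists 0%N.
  have : forall n, ((u n `^ p)%:E <= ereal_sup (range (fun n => (u n `^ p)%:E)))%E.
    by move=> n; apply: ereal_sup_ubound; exists n.
  case: (ereal_sup (range (fun n => (u n `^ p)%:E))) => [s|_ _|]//; last by rewrite leey.
  move=> us s0; rewrite lee_fin in s0.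
  have H : (ereal_sup (range (EFin \o u)) <= (s `^ p^-1)%:E)%E.
    apply: ge_ereal_sup => _ [n _ <-] /=; rewrite lee_fin.
    have := us n; rewrite lee_fin => un.
    have -> : u n = (u n `^ p) `^ p^-1 by rewrite -powRrM divff ?gt_eqF// powRr1.
    by apply: ge0_ler_powR => //; rewrite ?nnegrE ?invr_ge0 ?powR_ge0// ltW.
  have -> : s%:E = ((s `^ p^-1)%:E `^ p)%E.
    by rewrite poweR_EFin -powRrM mulVf ?gt_eqF// powRr1.
  apply: gt0_ler_poweR => //.
  - exact: ltW.
  - rewrite in_itv/= leey andbT; apply: (@le_trans _ _ (u 0%N)%:E); first by rewrite lee_fin.
    by apply: ereal_sup_ubound; exists 0%N.
  - by rewrite in_itv/= leey andbT lee_fin powR_ge0.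
apply: ge_ereal_sup => _ [n _ <-]; rewrite -poweR_EFin.
have un : ((u n)%:E <= ereal_sup (range (EFin \o u)))%E.
  by apply: ereal_sup_ubound; exists n.
apply: gt0_ler_poweR => //.
- exact: ltW.
- by rewrite in_itv/= leey andbT lee_fin.
- by rewrite in_itv/= leey andbT; apply: le_trans un; rewrite lee_fin.
Qed.

(** * Strict upper bound for the maximal function *)

Section tree_maximal.
Context d (T : measurableType d) (R : realType) (mu : {measure set T -> \bar R}).
Context (r : R) (C : nat -> T -> set T) (treeC : homogeneous_tree mu r C).
Local Notation r_gt0 := (tree_gt0 treeC).
Local Notation r_lt1 := (tree_lt1 treeC).

Definition tree_maximal (phi : T -> R) (x : T) : \bar R :=
  ereal_sup (range (fun N => ((r ^+ N)^-1)%:E * \int[mu]_(y in C N x) (phi y)%:E)%E).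

Definition tree_average (phi : T -> R) N x : R :=
  fine (\int[mu]_(y in C N x) (phi y)%:E) / r ^+ N.

(** The maximum starts at generation [N0], that of [Q]: a function vanishing off [Q] has smaller
    averages over larger cells. *)
Fixpoint running_max (phi : T -> R) N0 n x : R :=
  if n is n'.+1 then Num.max (running_max phi N0 n' x) (tree_average phi (N0 + n) x)
  else tree_average phi N0 x.

Context (phi : T -> R) (mphi : measurable_fun setT phi) (phi_ge0 : forall x, 0 <= phi x).
Context (N0 : nat) (x0 : T) (phi_off : forall x, ~ C N0 x0 x -> phi x = 0).
Context (f : R) (f_gt0 : 0 < f).
Context (int_phi : (\int[mu]_(y in C N0 x0) (phi y)%:E = (f * r ^+ N0)%:E)%E).

Local Notation Q := (C N0 x0).
Local Notation avg := (tree_average phi).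
Local Notation m_ := (running_max phi N0).

Let rX_gt0 N : 0 < r ^+ N. Proof. by rewrite exprn_gt0// r_gt0. Qed.

Let mQ : measurable Q. Proof. exact: (tree_measurable treeC). Qed.

Let mphiD D : measurable_fun D phi. Proof. exact: measurable_funTS. Qed.


Lemma saturatedQ n : (N0 <= n)%N -> saturated C n Q.
Proof. by move=> h; apply: (saturatedS treeC h); exact: (saturated_tree treeC). Qed.

Lemma integral_phi_setT : (\int[mu]_y (phi y)%:E = (f * r ^+ N0)%:E)%E.
Proof.
rewrite -int_phi [RHS]integral_mkcond; apply: eq_integral => x _.
rewrite patchE; case: ifPn => // /negP; rewrite inE => /phi_off ->//.
Qed.

Lemma tree_integral_le N x : (\int[mu]_(y in C N x) (phi y)%:E <= (f * r ^+ N0)%:E)%E.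
Proof.
rewrite -integral_phi_setT; apply: ge0_subset_integral => //.
- exact: (tree_measurable treeC).
- exact/measurable_EFinP.
- by move=> y _; rewrite lee_fin.
Qed.

Lemma tree_averageE N x :
  (\int[mu]_(y in C N x) (phi y)%:E = (tree_average phi N x * r ^+ N)%:E)%E.
Proof.
rewrite /tree_average divfK ?gt_eqF// fineK// ge0_fin_numE.
  by rewrite (le_lt_trans (tree_integral_le N x))// ltry.
by apply: integral_ge0 => y _; rewrite lee_fin.
Qed.

Lemma tree_average_ge0 N x : 0 <= avg N x.
Proof.
apply: divr_ge0; last exact: ltW.
by apply/fine_ge0/integral_ge0 => y _; rewrite lee_fin.
Qed.

Lemma tree_average_le N x : avg N x <= f * r ^+ N0 / r ^+ N.
Proof.
have := tree_integral_le N x.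
by rewrite tree_averageE lee_fin ler_pdivlMr.
Qed.

Lemma adapted_tree_average N : adapted C N (avg N).
Proof. by move=> x y /(tree_eq treeC) xy; rewrite /tree_average xy. Qed.

Lemma tree_averageQ x : Q x -> avg N0 x = f.
Proof.
move=> Qx; have : (avg N0 x * r ^+ N0)%:E = (f * r ^+ N0)%:E.
  by rewrite -tree_averageE (tree_eq treeC Qx).
by move=> [] /mulIf -> //; rewrite gt_eqF.
Qed.

Lemma running_max_ge0 n x : 0 <= m_ n x.
Proof.
by case: n => [|n] /=; rewrite ?le_max ?tree_average_ge0 ?orbT.
Qed.

Lemma running_max_nd x : {homo (fun n => m_ n x) : n n' / (n <= n')%N >-> n <= n'}.
Proof. by apply: homo_leq => [//|y z t|n]; [exact: le_trans|rewrite /= le_max lexx]. Qed.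

Lemma running_max_ge n x : avg (N0 + n) x <= m_ n x.
Proof. by case: n => [|n]; rewrite ?addn0//= le_max lexx orbT. Qed.

(** A crude bound, depending on [n], that makes the integrals at each finite stage finite, so that
    they can be subtracted. *)
Lemma running_max_le n x : m_ n x <= f * r ^+ N0 / r ^+ (N0 + n).
Proof.
have f0 : 0 <= f * r ^+ N0 by rewrite mulr_ge0// ltW.
elim: n => [|n IH] /=; first by rewrite addn0 tree_average_le.
rewrite ge_max tree_average_le andbT (le_trans IH)// ler_wpM2l//.
rewrite lef_pV2 ?posrE// ler_wiXn2l ?leq_add2l//; first exact: ltW r_gt0.
exact: ltW r_lt1.
Qed.

Lemma adapted_running_max n : adapted C (N0 + n) (m_ n).
Proof.
elim: n => [|n IH] x y /=; first by rewrite addn0; exact: adapted_tree_average.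
move=> xy; rewrite (adapted_tree_average xy); congr Num.max.
by apply: IH; apply: (tree_sub treeC _ xy); rewrite leq_add2l.
Qed.

(* [tree_average phi N] is the conditional expectation of [phi] given the
   [N]-th generation. *)
Lemma integral_mul_adapted N A (g : T -> R) : (forall x, 0 <= g x) -> adapted C N g ->
  saturated C N A ->
  (\int[mu]_(y in A) (phi y * g y)%:E = \int[mu]_(y in A) (avg N y * g y)%:E)%E.
Proof.
move=> g0 ag sA.
have mA := saturated_measurable treeC sA.
have mg D : measurable D -> measurable_fun D g.
  by move=> mD; exact: (adapted_measurable treeC ag).
have mavg D : measurable D -> measurable_fun D (avg N).
  by move=> mD; exact: (adapted_measurable treeC (@adapted_tree_average N)).
apply: (saturated_integral_eq treeC sA).
- by apply/measurable_EFinP; apply: measurable_funM => //; exact: mg.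
- by apply/measurable_EFinP; apply: measurable_funM; [exact: mavg|exact: mg].
- by move=> x _; rewrite lee_fin mulr_ge0.
- by move=> x _; rewrite lee_fin mulr_ge0// tree_average_ge0.
move=> x _; have mC := tree_measurable treeC N x.
rewrite [RHS](integral_adapted treeC (N := N)); last first.
  by move=> y z yz; rewrite (ag _ _ yz) (@adapted_tree_average N _ _ yz).
transitivity (\int[mu]_(y in C N x) (g x * phi y)%:E)%E.
  by apply: eq_integral => y; rewrite inE => /ag ->; rewrite mulrC.
rewrite integral_EFinZ// tree_averageE -!EFinM; congr EFin; ring.
Qed.

(** A cell of generation N < N0 carries at most the mass of [Q] and has larger measure, so its
    average is at most [f], which is the running maximum at stage 0. *)
Lemma tree_maximalE x : Q x -> tree_maximal phi x = ereal_sup (range (EFin \o (m_^~ x))).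
Proof.
move=> Qx; apply/eqP; rewrite eq_le; apply/andP; split; apply: ge_ereal_sup => _ [N _ <-] /=.
  have -> : (((r ^+ N)^-1)%:E * \int[mu]_(y in C N x) (phi y)%:E)%E = (avg N x)%:E.
    by rewrite tree_averageE -EFinM mulrC mulfK// gt_eqF.
  have [NN0|NN0] := leqP N0 N.
    apply: (@le_trans _ _ (m_ (N - N0) x)%:E).
      by rewrite lee_fin -{1}(subnKC NN0) running_max_ge.
    by apply: ereal_sup_ubound; exists (N - N0)%N.
  apply: (@le_trans _ _ (m_ 0%N x)%:E); last by apply: ereal_sup_ubound; exists 0%N.
  rewrite lee_fin /= tree_averageQ// (le_trans (tree_average_le _ _))//.
  rewrite ler_pdivrMr// ler_pM2l// ler_wiXn2l//; [exact: ltW r_gt0|exact: ltW r_lt1|exact: ltnW].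
elim: N => [|n IH].
  apply: ereal_sup_ubound; exists N0 => //=.
  by rewrite tree_averageE -EFinM mulrC mulfK// gt_eqF.
rewrite /= EFin_max ge_max IH/=; apply: ereal_sup_ubound; exists (N0 + n.+1)%N => //=.
by rewrite tree_averageE -EFinM mulrC mulfK// gt_eqF.
Qed.

Context (p : R) (p_gt1 : 1 < p).

Lemma tree_maximal_powE x : Q x ->
  ((tree_maximal phi x) `^ p)%E = limn (fun n => (m_ n x `^ p)%:E).
Proof.
move=> Qx; rewrite tree_maximalE// poweR_ereal_sup//; last first.
- by move=> n; exact: running_max_ge0.
- exact: lt_trans p_gt1.
apply/esym/cvg_lim => //; apply: ereal_nondecreasing_cvgn => n n' nn'.
rewrite lee_fin; apply: ge0_ler_powR; rewrite ?nnegrE ?running_max_ge0//.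
  by apply: ltW; exact: lt_trans p_gt1.
exact: running_max_nd.
Qed.

Lemma adapted_running_max_pow n (e : R) : adapted C (N0 + n) (fun x => m_ n x `^ e).
Proof. by move=> x y /adapted_running_max ->. Qed.

Lemma measurable_running_max_pow n (e : R) D : measurable D ->
  measurable_fun D (fun x => m_ n x `^ e).
Proof. by move=> mD; apply: (adapted_measurable treeC (@adapted_running_max_pow n e)). Qed.

Lemma measurable_tree_maximal_pow : measurable_fun Q (fun x => (tree_maximal phi x `^ p)%E).
Proof.
have H : measurable_fun Q (fun x => limn_esup (fun n => (m_ n x `^ p)%:E)).
  apply: measurable_fun_limn_esup => n; apply/measurable_EFinP.
  exact: measurable_running_max_pow.
apply: eq_measurable_fun H => x; rewrite inE => Qx; rewrite tree_maximal_powE//.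
apply: is_cvg_limn_esupE.
apply: ereal_nondecreasing_is_cvgn => n n' nn'.
rewrite lee_fin; apply: ge0_ler_powR; rewrite ?nnegrE ?running_max_ge0//.
  by apply: ltW; exact: lt_trans p_gt1.
exact: running_max_nd.
Qed.

(** Monotone convergence: a bound uniform in [n] passes to the limit. *)
Lemma integral_tree_maximal_pow_le (B : \bar R) :
  (forall n, \int[mu]_(x in Q) (m_ n x `^ p)%:E <= B)%E ->
  (\int[mu]_(x in Q) (tree_maximal phi x `^ p) <= B)%E.
Proof.
move=> H.
have p0 : 0 <= p by apply: ltW; exact: lt_trans p_gt1.
have nd x : {homo (fun n => (m_ n x `^ p)%:E) : n n' / (n <= n')%N >-> (n <= n')%E}.
  move=> n n' nn'; rewrite lee_fin; apply: ge0_ler_powR; rewrite ?nnegrE ?running_max_ge0//.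
  exact: running_max_nd.
rewrite (eq_integral (fun x => limn (fun n => (m_ n x `^ p)%:E))); last first.
  by move=> x; rewrite inE; exact: tree_maximal_powE.
rewrite monotone_convergence//.
- apply: lime_le; last exact: nearW.
  apply: ereal_nondecreasing_is_cvgn => n n' nn'.
  apply: le_integral_EFin => //; rewrite ?powR_ge0//.
  + exact: measurable_running_max_pow.
  + exact: measurable_running_max_pow.
  + by move=> x _; exact: powR_ge0.
  + by move=> x _; rewrite -lee_fin; exact: nd.
- by move=> n; apply/measurable_EFinP; exact: measurable_running_max_pow.
- by move=> n x _; rewrite lee_fin powR_ge0.
Qed.


Context (F : R) (int_phip : (\int[mu]_(y in Q) (phi y `^ p)%:E = (F * r ^+ N0)%:E)%E).

Let p_gt0 : 0 < p. Proof. exact: lt_trans p_gt1. Qed.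
Let p1_gt0 : 0 < p - 1. Proof. by rewrite subr_gt0. Qed.

Let bound n := f * r ^+ N0 / r ^+ (N0 + n).

Let bound_ge0 n : 0 <= bound n.
Proof. by rewrite divr_ge0 ?mulr_ge0// ltW. Qed.

Let U n := fine (\int[mu]_(x in Q) (m_ n x `^ p)%:E).
Let V n := fine (\int[mu]_(x in Q) (phi x * m_ n x `^ (p - 1))%:E).

Let mV n : measurable_fun Q (fun x => phi x * m_ n x `^ (p - 1)).
Proof. by apply: measurable_funM => //; exact: measurable_running_max_pow. Qed.

Let UE n : (\int[mu]_(x in Q) (m_ n x `^ p)%:E = (U n)%:E)%E.
Proof.
rewrite /U fineK// ge0_fin_numE; last by apply: integral_ge0 => x _; rewrite lee_fin powR_ge0.
apply: (@le_lt_trans _ _ (\int[mu]_(x in Q) (cst (bound n `^ p) x)%:E)%E).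
  apply: le_integral_EFin => //; first exact: measurable_running_max_pow.
    by move=> x _; rewrite powR_ge0.
  move=> x _; apply: ge0_ler_powR; rewrite ?nnegrE ?running_max_ge0//; first exact: ltW.
  exact: running_max_le.
by rewrite (integral_cst mu mQ (bound n `^ p)%:E) (tree_measure treeC) -EFinM ltry.
Qed.

Let VE n : (\int[mu]_(x in Q) (phi x * m_ n x `^ (p - 1))%:E = (V n)%:E)%E.
Proof.
rewrite /V fineK// ge0_fin_numE; last first.
  by apply: integral_ge0 => x _; rewrite lee_fin mulr_ge0// powR_ge0.
apply: (@le_lt_trans _ _ (\int[mu]_(x in Q) (bound n `^ (p - 1) * phi x)%:E)%E).
  apply: le_integral_EFin => //; first exact: measurable_funM.
    by move=> x _; rewrite mulr_ge0// powR_ge0.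
  move=> x _; rewrite mulrC ler_wpM2r//.
  apply: ge0_ler_powR; rewrite ?nnegrE ?running_max_ge0//; first exact: ltW.
  exact: running_max_le.
by rewrite integral_EFinZ ?powR_ge0// int_phi -EFinM ltry.
Qed.

(** The integrand of [D n.+1 - D n], with [phi] replaced by its average of generation [N0 + n.+1].
    It is 0 where the maximum does not change; where it jumps from a to b it is b^p + (p - 1) a^p -
    p b a^(p-1). *)
Let gain n x := (p - 1) * m_ n x `^ p + p * (avg (N0 + n.+1) x * m_ n.+1 x `^ (p - 1))
  - ((p - 1) * m_ n.+1 x `^ p + p * (avg (N0 + n.+1) x * m_ n x `^ (p - 1))).

Let gain_ge0 n x : 0 <= gain n x.
Proof.
rewrite /gain /=; case: (leP (m_ n x) (avg (N0 + n.+1) x)) => h; last by rewrite subrr.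
have := young_powR p_gt1 (tree_average_ge0 (N0 + n.+1) x) (running_max_ge0 n x).
by rewrite (@powR_split _ _ (avg _ _) p_gt1) ?tree_average_ge0//; lra.
Qed.

Let gain_gt0 n x : 0 < m_ n x -> m_ n x < avg (N0 + n.+1) x -> 0 < gain n x.
Proof.
rewrite /gain /= => m0 h; rewrite max_r; last exact: ltW.
have := young_powR_lt p_gt1 m0 h.
by rewrite (@powR_split _ _ (avg _ _) p_gt1) ?tree_average_ge0//; lra.
Qed.

Let adapted_gain n : adapted C (N0 + n.+1) (gain n).
Proof.
move=> x y xy; rewrite /gain (adapted_tree_average xy) (adapted_running_max xy).
by rewrite (@adapted_running_max n x y)//; apply: (tree_sub treeC _ xy); rewrite leq_add2l.
Qed.

Let D n := p * V n - (p - 1) * U n.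

Let integral_gain n : (\int[mu]_(x in Q) (gain n x)%:E = (D n.+1 - D n)%:E)%E.
Proof.
have N0n k : (N0 <= N0 + k)%N by rewrite leq_addr.
have mg k : measurable_fun Q (fun x => m_ k x `^ p) by exact: measurable_running_max_pow.
have mh k : measurable_fun Q (fun x => avg (N0 + n.+1) x * m_ k x `^ (p - 1)).
  apply: measurable_funM; last exact: measurable_running_max_pow.
  exact: (adapted_measurable treeC (@adapted_tree_average _)).
have mc k (h : T -> R) : measurable_fun Q h -> measurable_fun Q (fun x => k * h x).
  by move=> ?; exact: measurable_funM.
have g0 k x : 0 <= (p - 1) * m_ k x `^ p by rewrite mulr_ge0 ?powR_ge0// ltW.
have am0 k x : 0 <= avg (N0 + n.+1) x * m_ k x `^ (p - 1).
  by apply: mulr_ge0; [exact: tree_average_ge0|exact: powR_ge0].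
have h0 k x : 0 <= p * (avg (N0 + n.+1) x * m_ k x `^ (p - 1)).
  by apply: mulr_ge0; [exact: ltW|exact: am0].
(* Averaging is allowed because, for k <= n + 1, the running maximum [m_ k] is constant on cells of
   generation [N0 + n.+1]. *)
have adV k : (k <= n.+1)%N -> 
    (\int[mu]_(x in Q) (p * (avg (N0 + n.+1) x * m_ k x `^ (p - 1)))%:E = (p * V k)%:E)%E.
  move=> kn; rewrite integral_EFinZ//; [|exact: ltW].
  rewrite -integral_mul_adapted ?VE//; last exact: saturatedQ.
    by move=> x; rewrite powR_ge0.
  by apply: (adaptedS treeC _ (@adapted_running_max_pow k (p - 1))); rewrite leq_add2l.
have adU k : (\int[mu]_(x in Q) ((p - 1) * m_ k x `^ p)%:E = ((p - 1) * U k)%:E)%E.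
  by rewrite integral_EFinZ ?UE//; [move=> x _; rewrite powR_ge0|exact: ltW].
have mgain : measurable_fun Q (gain n) by exact: (adapted_measurable treeC (@adapted_gain n)).
have E1 : (\int[mu]_(x in Q) ((p - 1) * m_ n x `^ p +
      p * (avg (N0 + n.+1) x * m_ n.+1 x `^ (p - 1)))%:E
    = ((p - 1) * U n + p * V n.+1)%:E)%E.
  by rewrite integral_EFinD ?adU ?adV//; [exact: mc|exact: mc].
have E2 : (\int[mu]_(x in Q) ((p - 1) * m_ n.+1 x `^ p +
      p * (avg (N0 + n.+1) x * m_ n x `^ (p - 1)))%:E
    = ((p - 1) * U n.+1 + p * V n)%:E)%E.
  by rewrite integral_EFinD ?adU ?adV//; [exact: mc|exact: mc].
(* The subtracted terms are moved to the other side, so that only non-negative integrands are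
   added. *)
have : (((p - 1) * U n.+1 + p * V n)%:E + \int[mu]_(x in Q) (gain n x)%:E
    = ((p - 1) * U n + p * V n.+1)%:E)%E.
  rewrite -E1 -E2 -integral_EFinD//.
  - by apply: eq_integral => x _; rewrite /gain addrC subrK.
  - by apply: measurable_funD; exact: mc.
  - by move=> x _; rewrite addr_ge0.
case: (\int[mu]_(x in Q) (gain n x)%:E)%E => [g| |]//= [] E.
by congr EFin; rewrite /D; lra.
Qed.

Let D_nd : {homo D : n n' / (n <= n')%N >-> n <= n'}.
Proof.
apply: homo_leq => [//|y z t|n]; first exact: le_trans.
rewrite -subr_ge0 -lee_fin -integral_gain; apply: integral_ge0 => x _.
by rewrite lee_fin.
Qed.

(** A jump at one point is a jump on its whole cell of generation [N0 + n.+1], which has positive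
    measure. *)
Let D_lt n x : Q x -> 0 < m_ n x -> m_ n x < avg (N0 + n.+1) x -> D n < D n.+1.
Proof.
move=> Qx m0 h; rewrite -subr_gt0 -lte_fin -integral_gain.
apply: (@lt_le_trans _ _ (\int[mu]_(y in C (N0 + n.+1) x) (gain n y)%:E)%E).
  rewrite (integral_adapted treeC (N := N0 + n.+1)); last first.
    by move=> y z yz; rewrite (adapted_gain yz).
  by rewrite -EFinM lte_fin mulr_gt0// gain_gt0.
apply: ge0_subset_integral => //.
- exact: (tree_measurable treeC).
- by apply/measurable_EFinP; exact: (adapted_measurable treeC (@adapted_gain n)).
- by move=> y _; rewrite lee_fin.
- by apply: saturatedQ; rewrite ?leq_addr.
Qed.

Let D0 : D 0 = f `^ p * r ^+ N0.
Proof.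
have HU : U 0 = f `^ p * r ^+ N0.
  rewrite /U (eq_integral (cst (f `^ p)%:E)); last first.
    by move=> x; rewrite inE => Qx /=; rewrite tree_averageQ.
  by rewrite integral_cst// (tree_measure treeC).
have HV : V 0 = f `^ p * r ^+ N0.
  rewrite /V (eq_integral (fun x => (f `^ (p - 1) * phi x)%:E)); last first.
    by move=> x; rewrite inE => Qx /=; rewrite tree_averageQ// mulrC.
  rewrite integral_EFinZ ?powR_ge0// int_phi/= (powR_split p_gt1); last exact: ltW.
  ring.
by rewrite /D HU HV; ring.
Qed.

(** Young's inequality for [w * phi] and [m_ n], divided by [w] and integrated. *)
Let young_UV n w : 0 < w -> p * V n <= w `^ (p - 1) * (F * r ^+ N0) + (p - 1) / w * U n.
Proof.
move=> w0; rewrite -lee_fin.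
have mphip : measurable_fun Q (fun x => phi x `^ p).
  by apply: (measurableT_comp (measurable_powR p)).
have mU : measurable_fun Q (fun x => m_ n x `^ p) by exact: measurable_running_max_pow.
have k0 : 0 <= (p - 1) / w by rewrite divr_ge0// ltW.
have H1 x : Q x -> 0 <= phi x `^ p by rewrite powR_ge0.
have H2 x : Q x -> 0 <= m_ n x `^ p by rewrite powR_ge0.
have H3 x : Q x -> 0 <= phi x * m_ n x `^ (p - 1) by rewrite mulr_ge0 ?powR_ge0.
have w10 : 0 <= w `^ (p - 1) by rewrite powR_ge0.
rewrite EFinD (EFinM p) (EFinM (w `^ _)) (EFinM (_ / _)) -int_phip -UE -VE.
rewrite -!integral_EFinZ ?(ltW p_gt0)//.
rewrite -integral_EFinD//.
- apply: le_integral_EFin => //.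
  + exact: measurable_funM.
  + by apply: measurable_funD; exact: measurable_funM.
  + by move=> x _; rewrite !mulr_ge0 ?powR_ge0// ltW.
  move=> x _.
  have := young_powR p_gt1 (mulr_ge0 (ltW w0) (phi_ge0 x)) (running_max_ge0 n x).
  rewrite powRM ?(ltW w0)// (@powR_split _ _ w p_gt1) ?(ltW w0)// => H.
  rewrite -(ler_pM2l w0); apply: le_trans (le_trans H _).
    by rewrite le_eqVlt; apply/orP; left; apply/eqP; ring.
  by rewrite le_eqVlt; apply/orP; left; apply/eqP; field; rewrite gt_eqF.
- exact: measurable_funM.
- exact: measurable_funM.
- by move=> x _; rewrite mulr_ge0 ?powR_ge0.
- by move=> x _; rewrite mulr_ge0 ?powR_ge0.
Qed.

(** [B] depends on [phi]: it falls short of F w^p |Q| by a multiple of the growth of [D] up to one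
    jump, or is f^p |Q| if there is no jump. *)
Theorem tree_maximal_lt (w : R) : 1 < w -> f `^ p < F -> F * Hfun p w = f `^ p ->
  exists2 B, B < F * w `^ p * r ^+ N0 &
    (\int[mu]_(x in Q) (tree_maximal phi x `^ p) <= B%:E)%E.
Proof.
move=> w1 fF Fw.
have q0 := rX_gt0 N0.
have w0 : 0 < w by exact: lt_trans w1.
have f0 : 0 < f `^ p by exact: powR_gt0.
have [[n [x [Qx h]]]|noj] := pselect (exists n x, Q x /\ m_ n x < avg (N0 + n.+1) x).
  have m0 : 0 < m_ n x.
    by apply: lt_le_trans (running_max_nd x (leq0n n)); rewrite /= tree_averageQ.
  have Dlt := D_lt Qx m0 h.
  pose delta := D n.+1 - D 0.
  have delta0 : 0 < delta by rewrite subr_gt0; apply: le_lt_trans Dlt; exact: D_nd.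
  (* Inserting [young_UV] into the definition of [D j] leaves [U j] with the coefficient [k]. *)
  pose k := (p - 1) * (1 - w^-1).
  have k0 : 0 < k by rewrite mulr_gt0// subr_gt0 invf_lt1.
  exists (F * w `^ p * r ^+ N0 - delta / k); first by rewrite ltrBlDr ltrDl divr_gt0.
  apply: integral_tree_maximal_pow_le => i.
  (* A later index only enlarges the integral, and by then the growth [delta] has been collected. *)
  apply: (@le_trans _ _ (\int[mu]_(x in Q) (m_ (maxn i n.+1) x `^ p)%:E)%E).
    apply: le_integral_EFin => //; try exact: measurable_running_max_pow.
      by move=> y _; rewrite powR_ge0.
    move=> y _; apply: ge0_ler_powR; rewrite ?nnegrE ?running_max_ge0//; first exact: ltW.
    by apply: running_max_nd; rewrite leq_maxl.
  rewrite UE lee_fin.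
  have Dj : D n.+1 <= D (maxn i n.+1) by apply: D_nd; rewrite leq_maxr.
  set j := maxn _ _ in Dj *.
  rewrite -(ler_pM2l k0) mulrBr (mulrCA k delta) divff ?gt_eqF// mulr1.
  have Hj := young_UV j w0.
  have DE : D j = p * V j - (p - 1) * U j by [].
  have kU : k * U j = (p - 1) * U j - (p - 1) / w * U j by rewrite /k; ring.
  rewrite kU.
  (* The equation defining [w] enters here. *)
  have -> : k * (F * w `^ p * r ^+ N0) = w `^ (p - 1) * (F * r ^+ N0) - f `^ p * r ^+ N0.
    rewrite -Fw /Hfun (powR_split p_gt1 (ltW w0)) /k; field; rewrite gt_eqF//.
  by rewrite /delta; move: D0; lra.
(* Without a jump every running maximum stays equal to [f] on [Q]. *)
exists (f `^ p * r ^+ N0).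
  rewrite ltr_pM2r// (lt_le_trans fF)// ler_peMr ?(ltW (lt_trans f0 fF))//.
  have one : 1 = 1 `^ p :> R by rewrite powR1.
  by rewrite one; apply: ge0_ler_powR; rewrite ?nnegrE// ltW.
apply: integral_tree_maximal_pow_le => i.
rewrite (eq_integral (cst (f `^ p)%:E)).
  by rewrite integral_cst// (tree_measure treeC).
move=> x; rewrite inE => Qx /=; congr (_ `^ _)%:E.
elim: i => [|i IH]; first exact: tree_averageQ.
rewrite /= max_l ?IH//; rewrite leNgt; apply/negP => h; apply: noj.
by exists i, x; rewrite IH.
Qed.

End tree_maximal.

(** * Near-extremal functions *)

Lemma nneseries_geometric (R : realType) (a z : R) : 0 <= z -> z < 1 ->
  (\sum_(0 <= k <oo) (a * z ^+ k)%:E = (a / (1 - z))%:E)%E.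
Proof.
move=> z0 z1; have z1' : `|z| < 1 by rewrite ger0_norm.
have H := @cvg_geometric_series R a z z1'.
rewrite -(cvg_lim _ H)// -EFin_lim; last by apply/cvg_ex; eexists; exact: H.
by apply: congr_lim; apply/funext => n; rewrite /= /series/= sumEFin.
Qed.

Section geometric_profile.
Context d (T : measurableType d) (R : realType) (mu : {measure set T -> \bar R}).
Context (r : R) (C : nat -> T -> set T) (treeC : homogeneous_tree mu r C).
Context (m : nat) (m_gt0 : (0 < m)%N) (N0 : nat) (x0 : T).

Local Notation Q := (C N0 x0).
Local Notation alpha := (r ^+ m).

Let r_gt0 : 0 < r. Proof. exact: (tree_gt0 treeC). Qed.
Let alpha_gt0 : 0 < alpha. Proof. by rewrite exprn_gt0. Qed.
Let alpha_lt1 : alpha < 1. Proof. by rewrite exprn_ilt1 ?ltW ?(tree_lt1 treeC)// -lt0n. Qed.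

(* One subcube of generation [N + m] in each cube of generation [N]. *)
Definition corner N : set T := [set x | C (N + m) (xget x0 (C N x)) x].

Let xgetC N x : C N x (xget x0 (C N x)).
Proof. by apply: xgetPex; exists x; exact: (tree_mem treeC). Qed.

(** The point chosen by [xget] depends only on the cell, so it singles out one subcell per cell. *)
Lemma corner_tree N x : C N x `&` corner N = C (N + m) (xget x0 (C N x)).
Proof.
apply/seteqP; split => y /=; first by move=> [xy]; rewrite /corner/= (tree_eq treeC xy).
move=> H; suff xy : C N x y by split=> //; rewrite /corner/= (tree_eq treeC xy).
rewrite -(tree_eq treeC (@xgetC N x)); apply: (tree_sub treeC _ H).
exact: leq_addr.
Qed.

Lemma saturated_corner N : saturated C (N + m) (corner N).
Proof.
move=> x; rewrite /corner/= => Hx y xy.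
have xy' : C N x y by apply: (tree_sub treeC _ xy); exact: leq_addr.
by rewrite /= (tree_eq treeC xy') -(tree_eq treeC Hx).
Qed.

Let mcorner N : measurable (corner N).
Proof. by apply: (saturated_measurable treeC); exact: saturated_corner. Qed.

(** The indicator of [corner N] and the constant [alpha] have equal integrals over each cell of
    generation [N]. *)
Lemma measure_corner N A (a : R) : saturated C N A -> mu A = a%:E ->
  mu (A `&` corner N) = (alpha * a)%:E.
Proof.
move=> sA muA; have mA := saturated_measurable treeC sA.
rewrite setIC -integral_indic// EFinM -muA -integral_cst//.
apply: (saturated_integral_eq treeC sA).
- by apply/measurable_EFinP; exact: measurable_indic.
- exact: measurable_cst.
- by move=> x _; rewrite lee_fin.
- by move=> x _; rewrite lee_fin ltW.
move=> x _; have mC := tree_measurable treeC N x.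
rewrite integral_indic// integral_cst// setIC corner_tree !(tree_measure treeC).
by rewrite -EFinM exprD mulrC.
Qed.

Lemma measure_setD_corner N A (a : R) : saturated C N A -> mu A = a%:E ->
  mu (A `\` corner N) = ((1 - alpha) * a)%:E.
Proof.
move=> sA muA; have mA := saturated_measurable treeC sA.
have : mu A = (mu (A `\` corner N) + mu (A `&` corner N))%E by exact: measureDI.
rewrite (measure_corner sA muA) muA; case: (mu (A `\` corner N)) => [b| |]//= [] E.
by congr EFin; lra.
Qed.

(** The corners removed from [residual k] are cells of generation [N0 + k.+1 * m], so what is left
    is a union of cells of that generation and the next removal applies to it. *)
Fixpoint residual k : set T := if k is k'.+1 then residual k' `\` corner (N0 + k' * m) else Q.

Definition layer k := residual k `&` corner (N0 + k * m).

Lemma saturated_residual k : saturated C (N0 + k * m) (residual k).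
Proof.
elim: k => [|k IH] /=; first by rewrite addn0; exact: (saturated_tree treeC).
have -> : (N0 + k.+1 * m = N0 + k * m + m)%N by rewrite mulSn; ring.
rewrite setDE; apply: saturatedI.
  by apply: (saturatedS treeC _ IH); exact: leq_addr.
by apply: (saturatedC treeC); exact: saturated_corner.
Qed.

Lemma residual_sub k j : residual (k + j) `<=` residual k.
Proof.
elim: j => [|j IH]; first by rewrite addn0.
by rewrite addnS => x /= [/IH].
Qed.

Lemma measure_residual k A (a : R) : saturated C (N0 + k * m) A -> A `<=` residual k ->
  mu A = a%:E -> forall j, mu (A `&` residual (k + j)) = ((1 - alpha) ^+ j * a)%:E.
Proof.
move=> sA Ak muA; elim=> [|j IH].
  by rewrite addn0 expr0 mul1r setIidl.
rewrite addnS /= setIDA (measure_setD_corner _ IH) ?exprS ?mulrA//.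
apply: saturatedI; last exact: saturated_residual.
by apply: (saturatedS treeC _ sA); rewrite leq_add2l leq_mul2r leq_addr orbT.
Qed.

Lemma measure_layer k A (a : R) : saturated C (N0 + k * m) A -> A `<=` residual k ->
  mu A = a%:E -> forall j, mu (A `&` layer (k + j)) = (alpha * ((1 - alpha) ^+ j * a))%:E.
Proof.
move=> sA Ak muA j; rewrite /layer setIA.
rewrite (measure_corner _ (measure_residual sA Ak muA j))//.
apply: saturatedI; last exact: saturated_residual.
by apply: (saturatedS treeC _ sA); rewrite leq_add2l leq_mul2r leq_addr orbT.
Qed.

Lemma trivIset_layer : trivIset setT layer.
Proof.
apply: ltn_trivIset => j k kj; rewrite -subset0 => x [[_ ck] [Ej _]].
by move: Ej; rewrite -(subnKC kj) => /residual_sub /= [_].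
Qed.

Lemma measurable_layer k : measurable (layer k).
Proof.
apply: measurableI => //; exact: (saturated_measurable treeC (@saturated_residual k)).
Qed.

(** By disjointness [xget] returns the index of the only layer containing [x]. The value 0 is taken
    off [Q] and at the points that survive every removal. *)
Definition profile (c s : R) (x : T) : R :=
  if pselect (exists k, layer k x) is left _ then c * s ^+ xget 0%N [set k | layer k x] else 0.

Lemma profileE c s k x : layer k x -> profile c s x = c * s ^+ k.
Proof.
move=> kx; rewrite /profile; case: pselect => [_|[]]; last by exists k.
congr (_ * _ ^+ _).
have /= jx : [set k | layer k x] (xget 0%N [set k | layer k x]) by apply: xgetPex; exists k.
apply: contrapT => /eqP jk.
by have /trivIsetP/(_ _ _ I I jk) := trivIset_layer; rewrite -subset0 => /(_ x); apply.
Qed.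

Lemma profile_off c s x : (forall k, ~ layer k x) -> profile c s x = 0.
Proof. by move=> H; rewrite /profile; case: pselect => // -[k /H]. Qed.

Lemma profile_ge0 c s x : 0 <= c -> 0 <= s -> 0 <= profile c s x.
Proof.
by move=> c0 s0; rewrite /profile; case: pselect => // _; rewrite mulr_ge0// exprn_ge0.
Qed.

(** Powers of profiles are profiles, so one computation serves for the integrals of phi and of
    phi^p. *)
Lemma profile_pow c s (p : R) x : 0 <= c -> 0 <= s -> p != 0 ->
  profile c s x `^ p = profile (c `^ p) (s `^ p) x.
Proof.
move=> c0 s0 p0; rewrite /profile; case: pselect => [_|_]; last by rewrite powR0.
by rewrite powRM ?exprn_ge0// -!powR_mulrn ?powR_ge0// powRAC.
Qed.

Lemma measurable_profile c s D : measurable_fun D (profile c s).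
Proof.
apply: measurable_funTS => _ Y mY; rewrite setTI.
have -> : profile c s @^-1` Y = \bigcup_k (layer k `&` [set _ | Y (c * s ^+ k)]) `|`
    (~` (\bigcup_k layer k) `&` [set _ | Y 0]).
  apply/seteqP; split => x /=.
    move=> Yx; have [[k kx]|nk] := pselect (exists k, layer k x).
      by left; exists k => //; split=> //=; rewrite -(profileE _ _ kx).
    right; split; first by move=> [k _ kx]; apply: nk; exists k.
    by rewrite -(@profile_off c s x)// => k kx; apply: nk; exists k.
  move=> [[k _ [kx]]|[nk]] /=; first by rewrite (profileE _ _ kx).
  by rewrite profile_off// => k kx; apply: nk; exists k.
have mc (P : Prop) : measurable [set _ : T | P].
  have [p|np] := pselect P.
    by rewrite (_ : [set _ | P] = setT)//; apply/seteqP; split.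
  by rewrite (_ : [set _ | P] = set0)//; apply/seteqP; split.
apply: measurableU.
  apply: bigcupT_measurable => k; apply: measurableI => //; exact: measurable_layer.
apply: measurableI => //; apply: measurableC; apply: bigcupT_measurable => k.
exact: measurable_layer.
Qed.

(** Layer k + j occupies the fraction alpha (1 - alpha)^j of [A], which gives a geometric series of
    ratio [(1 - alpha) * s]. *)
Lemma integral_profile c s k A a : 0 <= c -> 0 <= s -> (1 - alpha) * s < 1 ->
  saturated C (N0 + k * m) A -> A `<=` residual k -> mu A = a%:E ->
  (\int[mu]_(x in A) (profile c s x)%:E = (c * s ^+ k * alpha / (1 - (1 - alpha) * s) * a)%:E)%E.
Proof.
move=> c0 s0 s1 sA Ak muA; have mA := saturated_measurable treeC sA.
pose L := \bigcup_j (A `&` layer (k + j)).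
have mAL j : measurable (A `&` layer (k + j)) by apply: measurableI => //; exact: measurable_layer.
have mL : measurable L by exact: bigcupT_measurable.
have LA : L `<=` A by move=> x [j _ []].
rewrite -(setDUK LA) ge0_integral_setU//; last 4 first.
- exact: measurableD.
- by apply/measurable_EFinP; exact: measurable_profile.
- by move=> x _; rewrite lee_fin profile_ge0.
- by apply/disj_setPS => x [? []].
(* A point of [A] outside [L] lies in no layer: those of index below [k] are disjoint from
   [residual k]. *)
rewrite [X in (_ + X)%E]integral0_eq; last first.
  move=> x [Ax nLx]; rewrite profile_off// => i ix; apply: nLx.
  have [ki|ik] := leqP k i; first by exists (i - k)%N => //; rewrite subnKC.
  have := Ak _ Ax; rewrite -(subnKC ik) => /residual_sub /= [_ H].
  by case: H; case: ix.
rewrite adde0 ge0_integral_bigcup//; last 3 first.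
- by apply/measurable_EFinP; exact: measurable_profile.
- by move=> x _; rewrite lee_fin profile_ge0.
- apply/trivIsetP => i j _ _ ij; have := trivIset_layer.
  move=> /trivIsetP/(_ (k + i)%N (k + j)%N I I); rewrite eqn_add2l => /(_ ij).
  by rewrite -!subset0 => H x [[_ ?] [_ ?]]; apply: (H x).
have b0 : 0 <= (1 - alpha) * s by rewrite mulr_ge0// subr_ge0 ltW.
rewrite (_ : c * _ * _ / _ * _ = c * s ^+ k * alpha * a / (1 - (1 - alpha) * s)); last first.
  by rewrite -!mulrA (mulrC a).
rewrite -nneseries_geometric//; apply: eq_eseriesr => j _.
rewrite (eq_integral (cst (c * s ^+ (k + j))%:E)); last first.
  by move=> x; rewrite inE => -[_ jx] /=; rewrite (profileE _ _ jx).
rewrite integral_cst// (measure_layer sA Ak muA) -EFinM; congr EFin.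
by rewrite exprD exprMn; ring.
Qed.

(** * Choice of the parameters of the profile *)

Section near_extremal.
Context (p f F w : R) (p_gt1 : 1 < p) (f_gt0 : 0 < f) (F_gt0 : 0 < F) (w_gt1 : 1 < w).
(** This ratio makes the average over a cell surviving k steps [w] times the value on layer k;
    [rhoE] then gives phi^p the average [F]. *)
Local Notation rho := ((1 - alpha / w) / (1 - alpha)).
Context (rhoE : w `^ p * (1 - (1 - alpha) * rho `^ p) = f `^ p / F * alpha).

Let w_gt0 : 0 < w. Proof. exact: lt_trans w_gt1. Qed.
Let p_gt0 : 0 < p. Proof. exact: lt_trans p_gt1. Qed.
Let alphaw : alpha / w < 1. Proof. by rewrite ltr_pdivrMr// mul1r (lt_trans alpha_lt1). Qed.

Let rho_ge0 : 0 <= rho.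
Proof. by rewrite divr_ge0// subr_ge0 ltW. Qed.

Let beta_rho : (1 - alpha) * rho = 1 - alpha / w.
Proof. by rewrite mulrC divfK// gt_eqF// subr_gt0. Qed.

Let beta_rhop : 1 - (1 - alpha) * rho `^ p = f `^ p / F * alpha / w `^ p.
Proof. by rewrite -rhoE [RHS]mulrC mulKf// gt_eqF// powR_gt0. Qed.

Let rhop_lt1 : (1 - alpha) * rho `^ p < 1.
Proof. by rewrite -subr_gt0 beta_rhop divr_gt0 ?powR_gt0// mulr_gt0// divr_gt0// powR_gt0. Qed.

Let integral_near k A a : saturated C (N0 + k * m) A -> A `<=` residual k -> mu A = a%:E ->
  (\int[mu]_(x in A) (profile (f / w) rho x)%:E = (f * rho ^+ k * a)%:E)%E.
Proof.
have a0 := alpha_gt0.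
move=> sA Ak muA; rewrite (@integral_profile _ _ k _ a)//.
- rewrite beta_rho; congr (_ * _)%:E.
  rewrite (_ : 1 - (1 - alpha / w) = alpha / w); last by ring.
  by set x := rho ^+ k; field; rewrite !gt_eqF.
- by rewrite divr_ge0// ltW.
- by rewrite beta_rho ltrBlDr ltrDl divr_gt0.
Qed.

Let saturatedQ0 : saturated C (N0 + 0 * m) Q.
Proof. by rewrite addn0; exact: (saturated_tree treeC). Qed.

(** Used twice: c = f / w gives F |Q|, and c = f gives F w^p |Q|. *)
Let integral_profile_pow c : 0 <= c ->
  (\int[mu]_(x in Q) (profile c rho x `^ p)%:E = (c `^ p * F * w `^ p / f `^ p * r ^+ N0)%:E)%E.
Proof.
move=> c0; have a0 := alpha_gt0.
under eq_integral do rewrite profile_pow ?gt_eqF//.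
rewrite (@integral_profile _ _ 0 _ (r ^+ N0)) ?powR_ge0//; last exact: (tree_measure treeC).
rewrite beta_rhop expr0 mulr1; congr (_ * _)%:E.
by field; rewrite !gt_eqF ?powR_gt0.
Qed.

Theorem near_extremal : exists phi : T -> R,
  [/\ measurable_fun setT phi, forall x, 0 <= phi x, forall x, ~ Q x -> phi x = 0,
      (\int[mu]_(x in Q) (phi x)%:E = (f * r ^+ N0)%:E)%E &
      (\int[mu]_(x in Q) (phi x `^ p)%:E = (F * r ^+ N0)%:E)%E /\
      ((F * w `^ p * r ^+ N0)%:E <= \int[mu]_(x in Q) (tree_maximal mu r C phi x `^ p))%E].
Proof.
have fw0 : 0 <= f / w by rewrite divr_ge0// ltW.
exists (profile (f / w) rho); set phi := profile _ _.
have mphi : measurable_fun setT phi by exact: measurable_profile.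
have phi0 x : 0 <= phi x by rewrite profile_ge0.
have phiQ x : ~ Q x -> phi x = 0.
  move=> nQx; apply: profile_off => k [kx _]; apply: nQx.
  by move: kx; rewrite -[k]add0n => /residual_sub.
have int1 : (\int[mu]_(x in Q) (phi x)%:E = (f * r ^+ N0)%:E)%E.
  rewrite (@integral_near 0 _ (r ^+ N0))//; last exact: (tree_measure treeC).
  by rewrite expr0 mulr1.
split => //; split.
  rewrite integral_profile_pow//; congr (_ * _)%:E.
  have wV : w^-1 `^ p = (w `^ p)^-1 by rewrite -(powR_inv1 (ltW w_gt0)) -powRrM mulN1r powRN.
  rewrite powRM ?invr_ge0 ?ltW// wV.
  by field; rewrite !gt_eqF ?powR_gt0.
have -> : (F * w `^ p * r ^+ N0 = f `^ p * F * w `^ p / f `^ p * r ^+ N0).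
  by field; rewrite gt_eqF// powR_gt0.
rewrite -integral_profile_pow; last exact: ltW.
have mQ : measurable Q by exact: (tree_measurable treeC).
apply: ge0_le_integral => //.
- by move=> x _; rewrite lee_fin powR_ge0.
- apply/measurable_EFinP; apply: (measurableT_comp (measurable_powR p)).
  exact: measurable_profile.
- exact: (measurable_tree_maximal_pow treeC mphi phi0 phiQ f_gt0 int1).
move=> x Qx; rewrite -poweR_EFin.
(* On layer k the cell of generation [N0 + k * m] around [x] lies in [residual k] and has average f
   rho^k, that is, [w] times the value of [phi] at [x]. *)
have H : ((profile f rho x)%:E <= tree_maximal mu r C phi x)%E.
  have [[k kx]|nk] := pselect (exists k, layer k x).
    rewrite (profileE _ _ kx); apply: ereal_sup_ubound; exists (N0 + k * m)%N => //.
    rewrite (@integral_near k _ (r ^+ (N0 + k * m))).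
    - by rewrite -EFinM mulrC mulfK// gt_eqF// exprn_gt0.
    - exact: (saturated_tree treeC).
    - by apply: saturated_residual; case: kx.
    - exact: (tree_measure treeC).
  rewrite profile_off; last by move=> k kx; apply: nk; exists k.
  apply: (@le_trans _ _ (((r ^+ 0)^-1)%:E * \int[mu]_(y in C 0 x) (phi y)%:E)%E).
    apply: mule_ge0; first by rewrite lee_fin expr0 invr1.
    by apply: integral_ge0 => y _; rewrite lee_fin.
  by apply: ereal_sup_ubound; exists 0%N.
apply: gt0_ler_poweR => //.
- exact: ltW.
- by rewrite in_itv/= leey andbT lee_fin profile_ge0// ltW.
- by rewrite in_itv/= leey andbT; apply: le_trans H; rewrite lee_fin profile_ge0// ltW.
Qed.

End near_extremal.
End geometric_profile.

(** * Dyadic cubes *)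

(** Boxes in the Borel space of plain tuples, where the product measure is defined before its
    completion. *)
Definition tuple_box (R : realType) (n : nat) (a b : 'I_n -> R) : set (n.-tuple R) :=
  [set x | forall i, a i <= tnth x i < b i].

Lemma measurable_tuple_box (R : realType) (n : nat) (a b : 'I_n -> R) :
  measurable (tuple_box a b).
Proof.
have -> : tuple_box a b = \bigcap_i ((@tnth n R)^~ i @^-1` `[a i, b i[%classic).
  apply/seteqP; split => x /=; first by move=> H i _; rewrite /= in_itv/=; exact: H.
  by move=> H i; have := H i I; rewrite /= in_itv.
apply: fin_bigcap_measurable => // i _; rewrite -[X in measurable X]setTI.
by apply: measurable_tnth => //; exact: measurable_itv.
Qed.

Lemma borel_lebesgue_box (R : realType) (n : nat) (a b : 'I_n -> R) (l : R) : 0 < l ->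
  (forall i, b i - a i = l) -> borel_lebesgue R n (tuple_box a b) = (l ^+ n)%:E.
Proof.
move=> l0; elim: n a b => [|n IH] a b ab.
  by rewrite /= diracE mem_set// => -[].
rewrite /= /prod_lebesgue /pushforward.
have -> : @tcons R n @^-1` tuple_box a b =
    `[a ord0, b ord0[%classic `*` tuple_box (a \o lift ord0) (b \o lift ord0).
  apply/seteqP; split => -[y t] /=.
    move=> H; split; first by have := H ord0; rewrite in_itv.
    by move=> i; have := H (lift ord0 i); rewrite tnthS.
  move=> [/= yab H] i; case: (unliftP ord0 i) => [j ->|->]; last by rewrite in_itv in yab.
  by have := H j; rewrite /= tnthS.
rewrite product_measure1E//; last exact: measurable_tuple_box.
rewrite IH//; last by move=> i; exact: ab.
have Hl := lebesgue_measure_itv `[a ord0, b ord0[.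
rewrite /= lte_fin -subr_gt0 ab l0 -EFinB ab in Hl.
by rewrite [X in (X * _)%E]Hl -EFinM exprS.
Qed.

Section dyadic.
Context (R : realType) (n : nat).
Local Notation Rn := (leb_space R n).

Definition dyadic_index N (x : Rn) : 'I_n -> int :=
  fun i => Num.floor (tnth (x : n.-tuple R) i * 2 ^+ N).

Definition dyadic_cell N (x : Rn) : set Rn := dyadic_box N (dyadic_index N x).

(** Sides are half-open, so the index of the cube around a point is given by integer parts. *)
Lemma dyadic_boxE N (k : 'I_n -> int) (x : Rn) : dyadic_box N k x <-> k = dyadic_index N x.
Proof.
have p2 : 0 < 2 ^+ N :> R by rewrite exprn_gt0.
split=> [H|-> i].
  apply/funext => i; apply/esym/floor_def.
  by have := H i; rewrite ler_pdivrMr// ltr_pdivlMr.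
by rewrite ler_pdivrMr// ltr_pdivlMr// floor_itv.
Qed.

Lemma measurable_dyadic_box N k : measurable (@dyadic_box R n N k).
Proof.
apply: caratheodory_measurable_mu_ext.
exact: (@measurable_tuple_box R n (fun i => (k i)%:~R / 2 ^+ N) (fun i => (k i + 1)%:~R / 2 ^+ N)).
Qed.

Lemma lebesgue_dyadic_box N k : lebesgue (@dyadic_box R n N k) = (((2 ^+ n)^-1) ^+ N)%:E.
Proof.
pose a i : R := (k i)%:~R / 2 ^+ N; pose b i : R := (k i + 1)%:~R / 2 ^+ N.
have p2 : 0 < (2 ^+ N)^-1 :> R by rewrite invr_gt0 exprn_gt0.
transitivity (borel_lebesgue R n (tuple_box a b)).
  by apply: measurable_mu_extE; exact: measurable_tuple_box.
rewrite (borel_lebesgue_box p2); last by move=> i; rewrite /a /b -mulrBl intrD addrC addKr mul1r.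
by rewrite !exprVn -!exprM mulnC.
Qed.

(** If k and k' are the integer parts of t and 2t, then 2k <= k' <= 2k + 1, so k' determines k. *)
Lemma dyadic_index_coarsen N (x y : Rn) :
  dyadic_index N.+1 x = dyadic_index N.+1 y -> dyadic_index N x = dyadic_index N y.
Proof.
move=> xy; apply/funext => i; have := congr1 (@^~ i) xy; rewrite /dyadic_index => {}xy.
apply/esym/floor_def.
have := floor_itv (tnth (x : n.-tuple R) i * 2 ^+ N).
set k := Num.floor (_ * 2 ^+ N) => kx.
have := floor_itv (tnth (y : n.-tuple R) i * 2 ^+ N.+1); rewrite -xy.
have := floor_itv (tnth (x : n.-tuple R) i * 2 ^+ N.+1).
set k' := Num.floor (_ * 2 ^+ N.+1) => k'x k'y.
have E (z : R) : z * 2 ^+ N.+1 = 2 * (z * 2 ^+ N) by rewrite exprS; ring.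
rewrite !E in k'x k'y.
move: kx k'x k'y; rewrite !intrD => /andP[k1 k2] /andP[k'1 k'2] /andP[k'3 k'4].
(* Strict inequalities between integers are sharpened by one unit before returning to the reals. *)
have : ((2 * k)%:~R : R) < (k' + 1)%:~R by rewrite intrD intrM; lra.
rewrite ltr_int => h1.
have : (k'%:~R : R) < (2 * k + 2)%:~R by rewrite intrD intrM; lra.
rewrite ltr_int => h2.
have {}h1 : 2 * k <= k' by lia.
have {}h2 : k' + 1 <= 2 * k + 2 by lia.
rewrite -(ler_int R) intrM in h1; rewrite -(ler_int R) !intrD intrM in h2.
by apply/andP; split; lra.
Qed.

(** A positive dimension makes the ratio 2^(-n) less than 1. *)
Lemma dyadic_tree : (0 < n)%N -> homogeneous_tree (@lebesgue R n) (2 ^+ n)^-1 dyadic_cell.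
Proof.
move=> n0; split.
- by rewrite invr_gt0 exprn_gt0.
- by rewrite invf_lt1 ?exprn_gt0// exprn_egt1 ?ltr1n// -lt0n.
- by move=> N x; apply/dyadic_boxE.
- by move=> N x y /dyadic_boxE; rewrite /dyadic_cell => ->.
- by move=> N x y /dyadic_boxE/dyadic_index_coarsen xy; apply/dyadic_boxE.
- by move=> N x; exact: measurable_dyadic_box.
- by move=> N x; exact: lebesgue_dyadic_box.
move=> N.
(* Finite functions into [int] form a countable type, hence index countably many boxes. *)
apply: (@sub_countable _ _ _ (range (fun k : {ffun 'I_n -> int} => @dyadic_box R n N k))).
  apply: subset_card_le => _ [x _ <-] /=; exists [ffun i => dyadic_index N x i] => //=.
  by rewrite /dyadic_cell; congr dyadic_box; apply/funext => i; rewrite ffunE.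
by apply: (sub_countable (card_image_le _ _)).
Qed.

Lemma dyadic_cubeE (A : set Rn) : dyadic_cube A <-> exists N x, A = dyadic_cell N x.
Proof.
split=> [[N [k ->]]|[N [x ->]]]; last by exists N, (dyadic_index N x).
(* The lower corner belongs to the half-open cube. *)
exists N, [tuple (k i)%:~R / 2 ^+ N | i < n]; congr dyadic_box.
apply/dyadic_boxE => i; rewrite tnth_mktuple lexx/= ltr_pM2r ?invr_gt0 ?exprn_gt0//.
by rewrite ltr_int ltrDl.
Qed.

Lemma averageE N x (g : Rn -> \bar R) : average (dyadic_cell N x) g =
  (((((2 ^+ n)^-1) ^+ N)^-1)%:E * \int[lebesgue]_(u in dyadic_cell N x) g u)%E.
Proof. by rewrite /average lebesgue_dyadic_box. Qed.

Lemma dyadic_maximalE (phi : Rn -> R) x : (forall u, 0 <= phi u) ->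
  dyadic_maximal phi x = tree_maximal (@lebesgue R n) (2 ^+ n)^-1 dyadic_cell phi x.
Proof.
move=> phi0; congr ereal_sup; apply/seteqP; split => y /=.
  move=> [_ [[N [k ->]] /dyadic_boxE ->] <-]; exists N => //.
  rewrite -averageE; congr average; apply/funext => u.
  by rewrite ger0_norm.
move=> [N _ <-]; exists (dyadic_cell N x).
  by split; [apply/dyadic_cubeE; exists N, x|apply/dyadic_boxE].
rewrite -averageE; congr average; apply/funext => u.
by rewrite ger0_norm.
Qed.

End dyadic.

(** * Non-existence of extremal functions *)

Theorem corollary1 (R : realType) (n : nat) (n_gt0 : (0 < n)%N)
    (p : R) (p_gt1 : 1 < p)
    (Q : set (leb_space R n)) (Q_dyadic : dyadic_cube Q)
    (f F : R) (f_gt0 : 0 < f) (fp_gt0 : 0 < f `^ p) (fp_ltF : f `^ p < F) :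
  ~ exists phi : leb_space R n -> R,
      admissible p Q f F phi /\
      average Q (fun u => (dyadic_maximal phi u `^ p)%E) = bellman p Q f F.
Proof.
move=> [phi [[mphi phi0 phiQ avgf avgF] phiB]].
have [N [x0 QE]] := (dyadic_cubeE Q).1 Q_dyadic; subst Q.
have tree := dyadic_tree R n_gt0.
set r := (2 ^+ n)^-1 in tree.
have q0 : 0 < r ^+ N by rewrite exprn_gt0// (tree_gt0 tree).
have avg_int (g : leb_space R n -> \bar R) a : average (dyadic_cell N x0) g = a%:E <->
    (\int[lebesgue]_(u in dyadic_cell N x0) g u = (a * r ^+ N)%:E)%E.
  rewrite averageE -/r; split => [H|->].
    by rewrite EFinM -H muleAC -EFinM mulVf ?gt_eqF// mul1e.
  by rewrite -EFinM mulrC mulfK// gt_eqF.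
have F0 : 0 < F by exact: lt_trans fp_ltF.
have p0 : 0 < p by lra.
have [w w1 [wq wH]] : exists2 w, 1 < w & w < p / (p - 1) /\ Hfun p w = f `^ p / F.
  by apply: Hfun_surj => //; [rewrite divr_gt0|rewrite ltr_pdivrMr// mul1r].
have w0 : 0 < w by lra.
have Hw : F * Hfun p w = f `^ p by rewrite wH mulrC divfK// gt_eqF.
have [B BF intB] := tree_maximal_lt tree mphi phi0 phiQ f_gt0 ((avg_int _ _).1 avgf) p_gt1
  ((avg_int _ _).1 avgF) w1 fp_ltF Hw.
(* [w2 < w] is so close to [w] that [F * w2 `^ p * |Q|] still exceeds [B]. *)
pose b := Num.max (B / (F * r ^+ N)) (((1 + w) / 2) `^ p).
pose w2 := (b `^ p^-1 + w) / 2.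
have hw : 0 <= (1 + w) / 2 by lra.
have powK (z : R) : 0 <= z -> (z `^ p) `^ p^-1 = z.
  by move=> z0; rewrite -powRrM divff ?gt_eqF// powRr1.
have b0 : 0 <= b by rewrite le_max powR_ge0 orbT.
have powVK : (b `^ p^-1) `^ p = b by rewrite -powRrM mulVf ?gt_eqF// powRr1.
have bw : b `^ p^-1 < w.
  rewrite -(powK w (ltW w0)); apply: gt0_ltr_powR; rewrite ?invr_gt0 ?nnegrE ?powR_ge0//.
  rewrite gt_max; apply/andP; split.
    by rewrite ltr_pdivrMr ?mulr_gt0// mulrCA mulrA.
  by apply: gt0_ltr_powR => //; rewrite ?nnegrE; lra.
(* The second entry of the maximum [b] keeps [w2] above 1. *)
have wb : (1 + w) / 2 <= b `^ p^-1.
  rewrite -{1}(powK _ hw); apply: ge0_ler_powR; rewrite ?nnegrE ?powR_ge0//.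
    by rewrite invr_ge0 ltW.
  by rewrite le_max lexx orbT.
have w21 : 1 < w2 by rewrite /w2; lra.
have w2w : w2 < w by rewrite /w2; lra.
have BF2 : B < F * w2 `^ p * r ^+ N.
  have : B / (F * r ^+ N) < w2 `^ p.
    apply: (@le_lt_trans _ _ b); first by rewrite le_max lexx.
    rewrite -powVK; apply: gt0_ltr_powR => //; rewrite ?nnegrE ?powR_ge0//; rewrite /w2; lra.
  by rewrite ltr_pdivrMr ?mulr_gt0// mulrCA mulrA.
(* Lowering [w] to [w2] leaves the slack that lets a positive r^m solve the discrete equation with
   some [w3 >= w2]. *)
have Hw2 : f `^ p / F < Hfun p w2 by rewrite -wH; exact: Hfun_decr.
have [m [w3 [m0 w23 w3E]]] := discrete_Hfun_surj p_gt1 (tree_gt0 tree) (tree_lt1 tree)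
  (divr_gt0 fp_gt0 F0) w21 (lt_trans w2w wq) Hw2.
have w31 : 1 < w3 by exact: lt_le_trans w23.
have [psi [mpsi psi0 psiQ int1 [int2 intM]]] := near_extremal tree m0 N x0 p_gt1 f_gt0 F0 w31 w3E.
have psiA : admissible p (dyadic_cell N x0) f F psi.
  by split => //; exact/avg_int.
(* Extremality of [phi] enters here: the supremum dominates the value at [psi]. *)
have : (average (dyadic_cell N x0) (fun u => (dyadic_maximal psi u `^ p)%E) <=
        average (dyadic_cell N x0) (fun u => (dyadic_maximal phi u `^ p)%E))%E.
  by rewrite phiB; apply: ereal_sup_ubound; exists psi.
rewrite !averageE lee_pmul2l ?lte_fin ?invr_gt0//.
have avgE g (g0 : forall u, 0 <= g u) :
  (\int[lebesgue]_(u in dyadic_cell N x0) (dyadic_maximal g u `^ p) =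
   \int[lebesgue]_(u in dyadic_cell N x0) (tree_maximal lebesgue r (@dyadic_cell R n) g u `^ p))%E.
  by apply: eq_integral => u _; rewrite dyadic_maximalE.
rewrite !avgE// => H.
(* The chain F w3^p |Q| <= int (M psi)^p <= int (M phi)^p <= B < F w2^p |Q| contradicts w2 <= w3. *)
have := le_trans (le_trans intM H) intB; rewrite lee_fin leNgt => /negP; apply.
apply: (lt_le_trans BF2); rewrite ler_pM2r// ler_pM2l//.
by apply: ge0_ler_powR; rewrite ?nnegrE//; lra.
Qed.
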